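(* (Cut Elimination.) For every nested sequent $\Gamma$: if $\Gamma$ is provable in $\mathsf{GLP_{NS}}+\mathsf{cut}$, then $\Gamma$ is provable in $\mathsf{GLP_{NS}}$.
   Context: Formulas are built from propositional atoms $p$ and their complements $\overline{p}$, the constants $\top,\bot$, the connectives $\wedge,\vee$, and modalities $\Box_i,\Diamond_i$ for each natural number $i$. Negation $\overline{A}$ is defined (not primitive) by $\overline{(p)}=\overline{p}$, $\overline{\overline{p}}=p$, $\overline{\top}=\bot$, $\overline{\bot}=\top$, $\overline{A\wedge B}=\overline{A}\vee\overline{B}$, $\overline{A\vee B}=\overline{A}\wedge\overline{B}$, $\overline{\Box_iA}=\Diamond_i\overline{A}$, $\overline{\Diamond_iA}=\Box_i\overline{A}$. A nested sequent is (inductively) a finite multiset of formulas and of expressions $[\Delta]_i$ with $\Delta$ a nested sequent and $i\in\mathbb{N}$; the comma denotes multiset union. A unary context $\Gamma\{\ \}$ is a nested sequent with one hole occurring in place of a formula (possibly inside nested brackets); $\Gamma\{\Upsilon\}$ is the result of filling the hole with the sequent $\Upsilon$, and $\Gamma\{\emptyset\}$ fills it with the empty sequent. The calculus $\mathsf{GLP_{NS}}$ has initial sequents $\Gamma\{p,\overline{p}\}$ and $\Gamma\{\top\}$ and rules (premises / conclusion): ($\wedge$) $\Gamma\{A\}$ and $\Gamma\{B\}$ / $\Gamma\{A\wedge B\}$; ($\vee$) $\Gamma\{A,B\}$ / $\Gamma\{A\vee B\}$; ($\Box$) $\Gamma\{[A,\Diamond_i\overline{A}]_i\}$ / $\Gamma\{\Box_iA\}$;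 ($\Diamond$) $\Gamma\{\Diamond_iA,[A,\Delta]_j\}$ / $\Gamma\{\Diamond_iA,[\Delta]_j\}$ for $i\le j$; ($\mathsf{tran}$) $\Gamma\{\Diamond_iA,[\Diamond_iA,\Delta]_j\}$ / $\Gamma\{\Diamond_iA,[\Delta]_j\}$ for $i\le j$; ($\mathsf{eucl}$) $\Gamma\{\Diamond_iA,[\Diamond_iA,\Delta]_j\}$ / $\Gamma\{[\Diamond_iA,\Delta]_j\}$ for $i<j$. A proof is a finite tree of sequents built by these rules whose leaves are initial sequents. The cut rule is: $\Gamma\{A\}$ and $\Gamma\{\overline{A}\}$ / $\Gamma\{\emptyset\}$, for any formula $A$; $\mathsf{GLP_{NS}}+\mathsf{cut}$ is the calculus with this rule added. *)

(* Defs.v *)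
From Stdlib Require Import List Permutation RelationClasses.
Import ListNotations.

Set Implicit Arguments.

Section Syntax.

Variable atom : Type.

Inductive formula : Type :=
| Atom (p : atom)
| NAtom (p : atom)
| Top
| Bot
| And (A B : formula)
| Or (A B : formula)
| Box (i : nat) (A : formula)
| Dia (i : nat) (A : formula).

Fixpoint neg (A : formula) : formula :=
  match A with
  | Atom p => NAtom p
  | NAtom p => Atom p
  | Top => Bot
  | Bot => Top
  | And A B => Or (neg A) (neg B)
  | Or A B => And (neg A) (neg B)
  | Box i A => Dia i (neg A)
  | Dia i A => Box i (neg A)
  end.

(* A nested sequent is represented by a list of items, an item being a formula
   or a bracket [D]_i; the comma is [++].  Lists are read as multisets through
   [meq] below. *)
Inductive item : Type :=
| Fml (A : formula)
| Brk (i : nat) (D : list item).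

Definition sequent : Type := list item.

(* Equality of nested multisets: the least equivalence relation that allows
   permuting items at every depth.  Multiplicities are preserved. *)
Inductive meq : sequent -> sequent -> Prop :=
| meq_perm G D : Permutation G D -> meq G D
| meq_brk i G G' D : meq G G' -> meq (Brk i G :: D) (Brk i G' :: D)
| meq_trans G D E : meq G D -> meq D E -> meq G E.

#[global] Instance meq_equivalence : Equivalence meq.
Proof.
split.
- intros G; apply meq_perm, Permutation_refl.
- intros G D H; induction H as [G D H|i G G' D _ IH|G D E _ IH1 _ IH2].
  + now apply meq_perm, Permutation_sym.
  + now apply meq_brk.
  + exact (meq_trans IH2 IH1).
- exact meq_trans.
Qed.

(* [Hole D] is "{ }, D" and [InBrk i C D] is "[C]_i, D".  Up to [meq] this
   covers every position of the hole. *)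
Inductive context : Type :=
| Hole (D : sequent)
| InBrk (i : nat) (C : context) (D : sequent).

Fixpoint fill (C : context) (U : sequent) : sequent :=
  match C with
  | Hole D => U ++ D
  | InBrk i C D => Brk i (fill C U) :: D
  end.

(* [GLP_NS Ps G]: G follows from the list Ps of premises by one rule instance;
   the initial sequents are the instances without premises. *)
Inductive GLP_NS : list sequent -> sequent -> Prop :=
| init_atom C p :
    GLP_NS [] (fill C [Fml (Atom p); Fml (NAtom p)])
| init_top C :
    GLP_NS [] (fill C [Fml Top])
| rule_and C A B :
    GLP_NS [fill C [Fml A]; fill C [Fml B]] (fill C [Fml (And A B)])
| rule_or C A B :
    GLP_NS [fill C [Fml A; Fml B]] (fill C [Fml (Or A B)])
| rule_box C i A :
    GLP_NS [fill C [Brk i [Fml A; Fml (Dia i (neg A))]]]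
           (fill C [Fml (Box i A)])
| rule_dia C i j A D : i <= j ->
    GLP_NS [fill C [Fml (Dia i A); Brk j (Fml A :: D)]]
           (fill C [Fml (Dia i A); Brk j D])
| rule_tran C i j A D : i <= j ->
    GLP_NS [fill C [Fml (Dia i A); Brk j (Fml (Dia i A) :: D)]]
           (fill C [Fml (Dia i A); Brk j D])
| rule_eucl C i j A D : i < j ->
    GLP_NS [fill C [Fml (Dia i A); Brk j (Fml (Dia i A) :: D)]]
           (fill C [Brk j (Fml (Dia i A) :: D)]).

Inductive GLP_NS_cut : list sequent -> sequent -> Prop :=
| cut_base Ps G : GLP_NS Ps G -> GLP_NS_cut Ps G
| rule_cut C A :
    GLP_NS_cut [fill C [Fml A]; fill C [Fml (neg A)]] (fill C []).

(* Existence of a finite proof tree.  Since every node may change the list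
   representing its sequent, rules apply to nested multisets. *)
Inductive provable (R : list sequent -> sequent -> Prop) : sequent -> Prop :=
| provable_step Ps G G' :
    R Ps G -> meq G G' -> (forall P, In P Ps -> provable R P) ->
    provable R G'.

End Syntax.

(* Main.v *)
(* Nested sequents are translated to a labelled calculus [L] over a tree of
   nodes, in which [Dia i A] at [u] puts [A] directly at every node that the
   rules tran, eucl and dia together can reach.  Labelled derivations transport
   along maps preserving this reachability, which yields weakening, contraction,
   inversion and all structural rules at once.

   Cut elimination in [L] goes by induction on the cut formula.  The only hard
   case is [Box i A] against [Dia i ~A]; there one needs Loeb's rule: if
   [A, Dia i ~A] at a new i-successor [y] of [x] is derivable, so is [A] alone.
   Whenever the derivation uses [Dia i ~A] to put [~A] at a node [z] below [y],
   cut it against [A] at [z], which is obtained by replaying the whole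
   derivation with [z] in place of [y].  Say that the pair (k, C) is spent at
   [z] if some [Dia k ~C] lies at [z] or at a node whose k-diamonds reach [z];
   a box rule on a spent pair closes at once.  If k is the least label on the
   path from [y] to [z], with C the formula boxed at the corresponding edge, then
   moving from [y] to [z] spends the new pair (k, C) and keeps every spent pair
   of level at most k.  Only finitely many pairs occur, so the replays terminate
   by a lexicographic argument on levels. *)

From Stdlib Require Import List Permutation Relations Lia Arith Classical Setoid.
Require Import Defs.
Import ListNotations.

Set Implicit Arguments.

(** * Labelled graphs and the travel of diamonds *)

Definition graph (W : Type) := nat -> W -> W -> Prop.

(** A diamond of level [i] takes [move_down] by the rule tran and [move_up] by the rule eucl. *)
Inductive move (W : Type) (E : graph W) (i : nat) : W -> W -> Prop :=
| move_down j u v : i <= j -> E j u v -> move E i u v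
| move_up j u v : i < j -> E j v u -> move E i u v.

Definition reach (W : Type) (E : graph W) (i : nat) : W -> W -> Prop :=
  clos_refl_trans W (move E i).

(** The nodes where the body of an [i]-diamond at [u] can be put: moves by tran and eucl, then one
    step down by dia. *)
Definition sees (W : Type) (E : graph W) (i : nat) (u v : W) : Prop :=
  exists j w, reach E i u w /\ i <= j /\ E j w v.

(** An edge goes to a [sees] step and not just to an edge, so that a new child can be mapped onto
    any node already seen. *)
Definition hom (W W' : Type) (E : graph W) (E' : graph W') (f : W -> W') : Prop :=
  forall k u v, E k u v -> sees E' k (f u) (f v).

(** [None] is the new child, whose freshness is thus guaranteed by the type. *)
Definition grow (W : Type) (E : graph W) (x : W) (i : nat) : graph (option W) :=
  fun k u v =>
    match u, v with
    | Some u, Some v => E k u v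
    | Some u, None => u = x /\ k = i
    | None, _ => False
    end.

(** * Reachability *)

Section Graphs.

Variables (W : Type) (E : graph W).

Lemma reach_le i k u v : i <= k -> reach E k u v -> reach E i u v.
Proof.
intros Hik H; induction H as [u v [j a b Hj He|j a b Hj He]|u|u w v _ IH1 _ IH2].
- apply rt_step, (move_down E (i := i) (j := j) _ _); [lia|exact He].
- apply rt_step, (move_up E (i := i) (j := j) _ _); [lia|exact He].
- apply rt_refl.
- exact (rt_trans _ _ _ _ _ IH1 IH2).
Qed.

(** Reversing a step down along label [j] gives a step up only at levels strictly below [j]; hence
    the drop from [k] to [i]. *)
Lemma reach_sym i k u v : i < k -> reach E k u v -> reach E i v u.
Proof.
intros Hik H; induction H as [u v [j a b Hj He|j a b Hj He]|u|u w v _ IH1 _ IH2].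
- apply rt_step, (move_up E (i := i) (j := j) _ _); [lia|exact He].
- apply rt_step, (move_down E (i := i) (j := j) _ _); [lia|exact He].
- apply rt_refl.
- exact (rt_trans _ _ _ _ _ IH2 IH1).
Qed.

Lemma sees_edge i j u v : i <= j -> E j u v -> sees E i u v.
Proof. intros Hij He; exists j, u; repeat split; [apply rt_refl|exact Hij|exact He]. Qed.

Lemma sees_reach i u v : sees E i u v -> reach E i u v.
Proof.
intros (j & w & Hr & Hj & He).
exact (rt_trans _ _ _ _ _ Hr (rt_step _ _ _ _ (move_down E _ _ Hj He))).
Qed.

Lemma sees_le i k u v : i <= k -> sees E k u v -> sees E i u v.
Proof.
intros Hik (j & w & Hr & Hj & He).
exists j, w; repeat split; [exact (reach_le Hik Hr)|lia|exact He].
Qed.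

Lemma reach_sees i u v w : reach E i u v -> sees E i v w -> sees E i u w.
Proof.
intros Hr (j & a & Hr' & Hj & He).
exists j, a; repeat split; [exact (rt_trans _ _ _ _ _ Hr Hr')|exact Hj|exact He].
Qed.

Lemma sees_trans i u v w : sees E i u v -> sees E i v w -> sees E i u w.
Proof. intros H; apply reach_sees, sees_reach, H. Qed.

Lemma hom_id : hom E E (fun u => u).
Proof. intros k u v He; exact (sees_edge (le_n k) He). Qed.

End Graphs.

Lemma hom_grow (W : Type) (E : graph W) x i : hom E (grow E x i) Some.
Proof. intros k u v He; exact (sees_edge (grow E x i) (Some u) (Some v) (le_n k) He). Qed.

Section Homs.

Variables (W W' : Type) (E : graph W) (E' : graph W') (f : W -> W').
Hypothesis Hf : hom E E' f.

Lemma reach_hom i u v : reach E i u v -> reach E' i (f u) (f v).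
Proof.
intros H; induction H as [u v [j a b Hj He|j a b Hj He]|u|u w v _ IH1 _ IH2].
- exact (reach_le Hj (sees_reach (Hf He))).
- exact (reach_sym Hj (sees_reach (Hf He))).
- apply rt_refl.
- exact (rt_trans _ _ _ _ _ IH1 IH2).
Qed.

Lemma sees_hom i u v : sees E i u v -> sees E' i (f u) (f v).
Proof.
intros (j & w & Hr & Hj & He).
exact (reach_sees (reach_hom Hr) (sees_le Hj (Hf He))).
Qed.

Lemma hom_lift x y i : sees E' i (f x) y ->
  hom (grow E x i) E' (fun o => match o with Some u => f u | None => y end).
Proof.
intros Hy k [u|] [v|]; simpl; try easy.
- apply Hf.
- intros [-> ->]; exact Hy.
Qed.

End Homs.

Lemma hom_comp (W1 W2 W3 : Type) (E1 : graph W1) (E2 : graph W2) (E3 : graph W3)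
    (f : W1 -> W2) (g : W2 -> W3) :
  hom E1 E2 f -> hom E2 E3 g -> hom E1 E3 (fun u => g (f u)).
Proof. intros Hf Hg k u v He; exact (sees_hom Hg (Hf _ _ _ He)). Qed.

Lemma hom_option_map (W W' : Type) (E : graph W) (E' : graph W') f x i :
  hom E E' f -> hom (grow E x i) (grow E' (f x) i) (option_map f).
Proof.
intros Hf k u v He.
assert (Hs : sees (grow E' (f x) i) i (Some (f x)) None).
{ apply sees_edge with (j := i); [lia|simpl; auto]. }
assert (H := hom_lift (hom_comp Hf (hom_grow E' (f x) i)) x Hs k u v He).
destruct u, v; exact H.
Qed.

Lemma neg_involutive (atom : Type) (A : formula atom) : neg (neg A) = A.
Proof. induction A; simpl; congruence. Qed.

(** * The labelled calculus *)

Section Labelled.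

Variable atom : Type.
Notation fml := (formula atom).

Definition content (W : Type) := W -> fml -> Prop.

Definition add (W : Type) (S : content W) (x : W) (F : fml) : content W :=
  fun u G => S u G \/ (u = x /\ G = F).

Definition spawn (W : Type) (S : content W) (Q : fml -> Prop) : content (option W) :=
  fun o G => match o with Some u => S u G | None => Q G end.

Definition loeb_pair (i : nat) (A : fml) : fml -> Prop :=
  fun G => G = A \/ G = Dia i (neg A).

(** Contents are predicates and principal formulas are kept, so contraction is built in. [P] limits
    the pairs that box rules may decompose. *)
Inductive L (P : nat -> fml -> Prop) :
    forall W : Type, graph W -> content W -> Prop :=
| L_atom W (E : graph W) (S : content W) x p :
    S x (Atom p) -> S x (NAtom p) -> L P E S
| L_top W (E : graph W) (S : content W) x :
    S x (Top atom) -> L P E S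
| L_and W (E : graph W) (S : content W) x A B :
    S x (And A B) -> L P E (add S x A) -> L P E (add S x B) -> L P E S
| L_or W (E : graph W) (S : content W) x A B :
    S x (Or A B) -> L P E (add (add S x A) x B) -> L P E S
| L_box W (E : graph W) (S : content W) x i A :
    P i A -> S x (Box i A) ->
    L P (grow E x i) (spawn S (loeb_pair i A)) -> L P E S
| L_dia W (E : graph W) (S : content W) x i A y :
    S x (Dia i A) -> sees E i x y -> L P E (add S y A) -> L P E S.

Definition D := L (fun _ _ => True).

Lemma L_mono (P Q : nat -> fml -> Prop) W (E : graph W) S :
  (forall i A, P i A -> Q i A) -> L P E S -> L Q E S.
Proof.
intros HPQ H; induction H.
- eapply L_atom; eassumption.
- eapply L_top; eassumption.
- eapply L_and; eassumption.
- eapply L_or; eassumption.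
- eapply L_box; eauto.
- eapply L_dia; eassumption.
Qed.

(** A derivation has finitely many box rules; the list of their pairs will bound the replays in
    Loeb's rule. *)
Lemma L_finite W (E : graph W) S :
  D E S -> exists l, L (fun i A => In (i, A) l) E S.
Proof.
intros H; induction H as
  [W E S x p H1 H2|W E S x H1|W E S x A B H1 _ [l1 IH1] _ [l2 IH2]
  |W E S x A B H1 _ [l IH]|W E S x i A _ H1 _ [l IH]|W E S x i A y H1 H2 _ [l IH]].
- exists []; eapply L_atom; eassumption.
- exists []; eapply L_top; eassumption.
- exists (l1 ++ l2); eapply L_and; [eassumption| |].
  + eapply L_mono; [|exact IH1]; simpl; intros; apply in_or_app; auto.
  + eapply L_mono; [|exact IH2]; simpl; intros; apply in_or_app; auto.
- exists l; eapply L_or; eassumption.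
- exists ((i, A) :: l); eapply L_box; [left; reflexivity|eassumption|].
  eapply L_mono; [|exact IH]; simpl; auto.
- exists l; eapply L_dia; eassumption.
Qed.

(* [F] is covered at [x] if it is there or has already been decomposed there. *)
Inductive cov (W : Type) (E : graph W) (S : content W) : W -> fml -> Prop :=
| cov_in x F : S x F -> cov E S x F
| cov_andl x A B : cov E S x A -> cov E S x (And A B)
| cov_andr x A B : cov E S x B -> cov E S x (And A B)
| cov_or x A B : cov E S x A -> cov E S x B -> cov E S x (Or A B)
| cov_box x i A y : sees E i x y -> cov E S y A -> cov E S y (Dia i (neg A)) ->
    cov E S x (Box i A).

Lemma cov_hom W W' (E : graph W) (E' : graph W') S S' f x F :
  hom E E' f -> (forall u G, S u G -> cov E' S' (f u) G) ->
  cov E S x F -> cov E' S' (f x) F.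
Proof.
intros Hf HS H; induction H as [x F H|x A B _ IH|x A B _ IH
  |x A B _ IH1 _ IH2|x i A y Hs _ IH1 _ IH2].
- exact (HS _ _ H).
- exact (cov_andl _ IH).
- exact (cov_andr _ IH).
- exact (cov_or IH1 IH2).
- exact (cov_box (sees_hom Hf Hs) IH1 IH2).
Qed.

Lemma cov_incl W (E : graph W) (S S' : content W) x F :
  (forall u G, S u G -> S' u G) -> cov E S x F -> cov E S' x F.
Proof.
intros HS; apply (cov_hom (f := fun u => u)); [apply hom_id|].
intros u G H; apply cov_in, HS, H.
Qed.

Lemma add_l W (S : content W) x F u G : S u G -> add S x F u G.
Proof. now left. Qed.

Lemma add_r W (S : content W) x F : add S x F x F.
Proof. now right. Qed.

Local Hint Resolve add_l add_r : core.

(** A rule on a formula present in the target is repeated there. If the formula is only covered, the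
    rule is skipped: the new formulas of some premise are covered too. Weakening, contraction and
    inversion are special cases. *)
Lemma L_hom P W (E : graph W) S : L P E S ->
  forall W' (E' : graph W') S' f, hom E E' f ->
  (forall u F, S u F -> cov E' S' (f u) F) -> L P E' S'.
Proof.
intros H; induction H as
  [W E S x p H1 H2|W E S x H1|W E S x A B H1 _ IH1 _ IH2
  |W E S x A B H1 _ IH|W E S x i A HP H1 _ IH|W E S x i A y H1 H2 _ IH];
  intros W' E' S' f Hf HS.
- apply HS in H1; apply HS in H2; inversion H1; inversion H2; subst.
  eapply L_atom; eassumption.
- apply HS in H1; inversion H1; subst; eapply L_top; eassumption.
- apply HS in H1; inversion H1 as [? ? H|? ? ? H|? ? ? H| |]; subst.
  + apply (L_and H).
    * apply (IH1 _ _ _ f Hf); intros u F [Hu|[-> ->]]; [|apply cov_in; auto].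
      apply (cov_incl (S := S')); auto.
    * apply (IH2 _ _ _ f Hf); intros u F [Hu|[-> ->]]; [|apply cov_in; auto].
      apply (cov_incl (S := S')); auto.
  + apply (IH1 _ _ _ f Hf); intros u F [Hu|[-> ->]]; auto.
  + apply (IH2 _ _ _ f Hf); intros u F [Hu|[-> ->]]; auto.
- apply HS in H1; inversion H1 as [? ? H| | |? ? ? Ha Hb|]; subst.
  + apply (L_or H).
    apply (IH _ _ _ f Hf); intros u F [[Hu|[-> ->]]|[-> ->]]; try (apply cov_in; auto; fail).
    apply (cov_incl (S := S')); auto.
  + apply (IH _ _ _ f Hf); intros u F [[Hu|[-> ->]]|[-> ->]]; auto.
- apply HS in H1; inversion H1 as [? ? H| | | |? ? ? y Hs Ha Hb]; subst.
  + apply (L_box HP H).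
    apply (IH _ _ _ (option_map f)); [apply hom_option_map, Hf|].
    intros [u|] F Hu; simpl in *; [|apply cov_in; exact Hu].
    refine (cov_hom (hom_grow E' (f x) i) _ (HS _ _ Hu)).
    intros v G Hv; apply cov_in; exact Hv.
  (* The box is already decomposed at [y], so the fresh node is mapped to [y]. *)
  + apply (IH _ _ _ _ (hom_lift Hf _ Hs)).
    intros [u|] F; simpl; [auto|]; intros [-> | ->]; assumption.
- apply HS in H1; inversion H1 as [? ? H| | | |]; subst.
  apply (L_dia H (sees_hom Hf H2)).
  apply (IH _ _ _ f Hf); intros u F [Hu|[-> ->]]; [|apply cov_in; auto].
  apply (cov_incl (S := S')); auto.
Qed.

Lemma L_incl P W (E : graph W) (S S' : content W) :
  (forall u F, S u F -> S' u F) -> L P E S -> L P E S'.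
Proof.
intros HS H; apply (L_hom H (hom_id E)); intros u F Hu; apply cov_in, HS, Hu.
Qed.

Lemma D_identity (F : fml) : forall W (E : graph W) (S : content W) x,
  S x F -> S x (neg F) -> D E S.
Proof.
induction F as [p|p| | |A IHA B IHB|A IHA B IHB|i A IHA|i A IHA];
  intros W E S x H1 H2; simpl in *.
- eapply L_atom; eassumption.
- eapply L_atom; eassumption.
- eapply L_top; eassumption.
- eapply L_top; eassumption.
- apply (L_or H2); apply (L_and (x := x) (A := A) (B := B)).
  + auto.
  + apply (IHA _ _ _ x); auto.
  + apply (IHB _ _ _ x); auto.
- apply (L_or H1); apply (L_and (x := x) (A := neg A) (B := neg B)).
  + auto.
  + apply (IHA _ _ _ x); auto.
  + apply (IHB _ _ _ x); auto.
- apply (L_box I H1); apply (L_dia (x := Some x) (A := neg A) (i := i) (y := None)).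
  + exact H2.
  + apply sees_edge with (j := i); [lia|simpl; auto].
  + apply (IHA _ _ _ None); [apply add_l; left; reflexivity|auto].
- apply (L_box I H2); apply (L_dia (x := Some x) (A := A) (i := i) (y := None)).
  + exact H1.
  + apply sees_edge with (j := i); [lia|simpl; auto].
  + apply (IHA _ _ _ None); [auto|apply add_l; left; reflexivity].
Qed.

(** * Erasing a formula from a derivation *)

Definition extends W W' (E : graph W) (S : content W) (E' : graph W') (S' : content W')
    (h : W -> W') : Prop :=
  hom E E' h /\ forall u G, S u G -> S' (h u) G.

Lemma extends_incl W W' (E : graph W) S (E' : graph W') (S1 S2 : content W') h :
  (forall u G, S1 u G -> S2 u G) -> extends E S E' S1 h -> extends E S E' S2 h.
Proof. intros Hi [H1 H2]; split; auto. Qed.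

Lemma extends_grow W W' (E : graph W) S (E' : graph W') S' h x i Q :
  extends E S E' S' h ->
  extends E S (grow E' x i) (spawn S' Q) (fun u => Some (h u)).
Proof.
intros [H1 H2]; split; [exact (hom_comp H1 (hom_grow E' x i))|].
intros u G Hu; simpl; auto.
Qed.

(** One member of each dual pair of literals, constants and modalities, chosen so that its uses in a
    derivation can be replaced one by one. *)
Definition passive (F : fml) : Prop :=
  match F with Atom _ | Bot _ | Dia _ _ => True | _ => False end.

(** A passive [F] is used only to close against its dual literal or to send the body of a diamond to
    a node seen. The two hypotheses do this without [F], at whatever stage the derivation has
    reached. *)
Lemma D_erase W0 (E0 : graph W0) (S0 : content W0) (x0 : W0) (F : fml) :
  passive F ->
  (forall p, F = Atom p -> forall W' (E' : graph W') S' h,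
     extends E0 S0 E' S' h -> S' (h x0) (NAtom p) -> D E' S') ->
  (forall i B, F = Dia i B -> forall W' (E' : graph W') S' h z,
     extends E0 S0 E' S' h -> sees E' i (h x0) z -> D E' (add S' z B) -> D E' S') ->
  D E0 (add S0 x0 F) -> D E0 S0.
Proof.
intros Hpas Hatom Hdia H.
(* [h] maps the original tree and [g] the tree of the derivation into the current target, where only
   [F] at [h x0] may be missing. *)
cut (forall P W (E : graph W) S, L P E S ->
  forall W' (E' : graph W') S' h g, extends E0 S0 E' S' h -> hom E E' g ->
  (forall u G, S u G -> S' (g u) G \/ (g u = h x0 /\ G = F)) -> D E' S').
{ intros Hcut; apply (Hcut _ _ _ _ H _ E0 S0 (fun u => u) (fun u => u)).
  - split; [apply hom_id|auto].
  - apply hom_id.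
  - intros u G Hu; exact Hu. }
clear H; intros P W E S H; induction H as
  [W E S x p H1 H2|W E S x H1|W E S x A B H1 _ IH1 _ IH2
  |W E S x A B H1 _ IH|W E S x i A HP H1 _ IH|W E S x i A y H1 H2 _ IH];
  intros W' E' S' h g He Hg HS.
- destruct (HS _ _ H2) as [H2'|[_ <-]]; [|destruct Hpas].
  destruct (HS _ _ H1) as [H1'|[Hx <-]].
  + eapply L_atom; eassumption.
  + apply (Hatom p eq_refl _ _ _ _ He); rewrite <- Hx; exact H2'.
- destruct (HS _ _ H1) as [H1'|[_ <-]]; [|destruct Hpas].
  eapply L_top; eassumption.
- destruct (HS _ _ H1) as [H1'|[_ <-]]; [|destruct Hpas].
  apply (L_and H1').
  + apply (IH1 _ _ _ h g); [apply (extends_incl (S1 := S')); auto|exact Hg|].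
    intros u G [Hu|[-> ->]]; [destruct (HS _ _ Hu)|]; auto.
  + apply (IH2 _ _ _ h g); [apply (extends_incl (S1 := S')); auto|exact Hg|].
    intros u G [Hu|[-> ->]]; [destruct (HS _ _ Hu)|]; auto.
- destruct (HS _ _ H1) as [H1'|[_ <-]]; [|destruct Hpas].
  apply (L_or H1').
  apply (IH _ _ _ h g); [apply (extends_incl (S1 := S')); auto|exact Hg|].
  intros u G [[Hu|[-> ->]]|[-> ->]]; [destruct (HS _ _ Hu)| |]; auto.
- destruct (HS _ _ H1) as [H1'|[_ <-]]; [|destruct Hpas].
  apply (L_box I H1').
  apply (IH _ _ _ (fun u => Some (h u)) (option_map g)).
  + apply extends_grow, He.
  + apply hom_option_map, Hg.
  + intros [u|] G Hu; simpl in *; [|auto].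
    destruct (HS _ _ Hu) as [|[-> ->]]; auto.
- assert (Hprem : D E' (add S' (g y) A)).
  { apply (IH _ _ _ h g); [apply (extends_incl (S1 := S')); auto|exact Hg|].
    intros u G [Hu|[-> ->]]; [destruct (HS _ _ Hu)|]; auto. }
  assert (Hs := sees_hom Hg H2).
  destruct (HS _ _ H1) as [H1'|[Hx <-]].
  + exact (L_dia H1' Hs Hprem).
  + rewrite Hx in Hs; exact (Hdia i A eq_refl _ _ _ _ _ He Hs Hprem).
Qed.


(** * Loeb's rule *)

Section Potential.

Variables (N M : nat).

(** The numbers of pairs at each level act as digits in base [M + 1], lower levels being more
    significant. This turns the lexicographic comparison into one of numbers. *)
Definition potential (u : list (nat * fml)) : nat :=
  list_sum (map (fun p => (M + 1) ^ (N - fst p)) u).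

(** A discarded pair has level above [k], so [M + 1] times its weight is at most the weight of level
    [k]. Both sides carry the factor [M + 1] to avoid the exponent [N - k - 1], which truncates at
    [k = N]. *)
Lemma potential_split k (u : list (nat * fml)) :
  (forall p, In p u -> fst p <= N) -> k <= N ->
  potential u * (M + 1) <=
  potential (filter (fun p => fst p <=? k) u) * (M + 1) + length u * (M + 1) ^ (N - k).
Proof.
unfold potential; induction u as [|[j C] u IH]; intros Hu Hk; [simpl; lia|].
specialize (IH (fun p Hp => Hu p (or_intror Hp)) Hk).
specialize (Hu (j, C) (or_introl eq_refl)); simpl in *.
destruct (Nat.leb_spec j k) as [Hj|Hj]; simpl; [lia|].
assert (Hp : (M + 1) ^ (N - j) * (M + 1) <= (M + 1) ^ (N - k)).
{ replace ((M + 1) ^ (N - j) * (M + 1)) with ((M + 1) ^ Datatypes.S (N - j)) by (simpl; lia).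
  apply Nat.pow_le_mono_r; lia. }
lia.
Qed.

(* Discarding every pair above level [k] costs less than the weight of one pair
   at level [k]. *)
Lemma potential_increase k C (u : list (nat * fml)) :
  (forall p, In p u -> fst p <= N) -> k <= N -> length u <= M ->
  potential u < potential ((k, C) :: filter (fun p => fst p <=? k) u).
Proof.
intros Hu Hk Hlen; assert (H := potential_split _ Hu Hk).
unfold potential in *; simpl.
set (a := list_sum _) in *; set (b := list_sum _) in *.
assert (Hp : (M + 1) ^ (N - k) <> 0) by (apply Nat.pow_nonzero; lia).
set (c := (M + 1) ^ (N - k)) in *; nia.
Qed.

Lemma potential_bound (u : list (nat * fml)) :
  length u <= M -> potential u <= M * (M + 1) ^ N.
Proof.
intros Hlen; enough (H : potential u <= length u * (M + 1) ^ N) by nia.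
unfold potential; clear Hlen; induction u as [|[j C] u IH]; simpl; [lia|].
assert ((M + 1) ^ (N - j) <= (M + 1) ^ N) by (apply Nat.pow_le_mono_r; lia).
lia.
Qed.

End Potential.

Section Loeb.

Variables (W0 : Type) (E0 : graph W0) (S0 : content W0) (x0 : W0) (i : nat) (A : fml).
Hypothesis cutA : forall W (E : graph W) (S : content W) x,
  D E (add S x A) -> D E (add S x (neg A)) -> D E S.
Variable l : list (nat * fml).
Hypothesis Hder :
  L (fun k C => In (k, C) l) (grow E0 x0 i) (spawn S0 (loeb_pair i A)).

(** The case [v = y] is separate because a node need not see itself; it makes the child created by a
    box rule spend the pair of that rule. *)
Definition spent W (E : graph W) (S : content W) (y : W) (p : nat * fml) : Prop :=
  exists v, S v (Dia (fst p) (neg (snd p))) /\ (v = y \/ sees E (fst p) v y).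

Lemma spent_mono W W' (E : graph W) (E' : graph W') S S' h y p :
  extends E S E' S' h -> spent E S y p -> spent E' S' (h y) p.
Proof.
intros [Hh HS] (v & Hv & Hvy); exists (h v); split; [exact (HS _ _ Hv)|].
destruct Hvy as [-> |Hvy]; [now left|right; exact (sees_hom Hh Hvy)].
Qed.

(** A path of level [k] is also one of every lower level, so it prolongs the path by which the
    diamond gets to [y]. *)
Lemma spent_sees W (E : graph W) (S : content W) k y z p :
  fst p <= k -> sees E k y z -> spent E S y p -> spent E S z p.
Proof.
intros Hp Hyz (v & Hv & Hvy); exists v; split; [exact Hv|right].
assert (H := sees_le Hp Hyz).
destruct Hvy as [-> |Hvy]; [exact H|exact (sees_trans Hvy H)].
Qed.

(** The child created by the box contains [C], and the spent diamond reaches it and adds [neg C]. *)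
Lemma spent_box W (E : graph W) (S : content W) w j C :
  S w (Box j C) -> spent E S w (j, C) -> D E S.
Proof.
intros Hw (v & Hv & Hvw); simpl in *.
apply (L_box I Hw); apply (L_dia (x := Some v) (A := neg C) (i := j) (y := None)).
- exact Hv.
- assert (Hn : sees (grow E w j) j (Some w) None)
    by (apply sees_edge with (j := j); [lia|simpl; auto]).
  destruct Hvw as [-> |Hvw]; [exact Hn|].
  exact (sees_trans (sees_hom (hom_grow E w j) Hvw) Hn).
- apply (D_identity C) with (x := None); [apply add_l; left; reflexivity|apply add_r].
Qed.

(** A certificate that replaying at [z] instead of [y] makes progress over [u]; [k] is the level of
    the path from [y] to [z]. *)
Definition fresh_pair (u : list (nat * fml)) W (E : graph W) S (y z : W) : Prop :=
  exists k C, i <= k /\ In (k, C) l /\ ~ In (k, C) u /\ sees E k y z /\ spent E S z (k, C).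

Lemma fresh_pair_mono u W W' (E : graph W) (E' : graph W') S S' h y z :
  extends E S E' S' h -> fresh_pair u E S y z -> fresh_pair u E' S' (h y) (h z).
Proof.
intros He (k & C & Hk & Hl & Hu & Hs & Hsp); exists k, C; repeat split; auto.
- exact (sees_hom (proj1 He) Hs).
- exact (spent_mono He Hsp).
Qed.

(** [Hder] carried out with [y'] for its fresh node, where [A] is given but [Dia i (neg A)] is
    not. *)
Definition replay (u : list (nat * fml)) : Prop :=
  forall W' (E' : graph W') (S' : content W') h y',
  extends E0 S0 E' S' h -> sees E' i (h x0) y' -> S' y' A ->
  (forall p, In p u -> spent E' S' y' p) -> D E' S'.

Lemma extends_add W W' (E : graph W) S (E' : graph W') (S' : content W') h y F :
  extends E S E' S' h -> extends E S E' (add S' y F) h.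
Proof. apply extends_incl; auto. Qed.

Lemma extends_self_add W (E : graph W) S y F :
  extends E S E (add S y F) (fun u => u).
Proof. split; [apply hom_id|auto]. Qed.

(* In the induction, [Z] is the set of nodes created by the derivation that
   [Dia i (neg A)] at [y] reaches, and [g] maps its tree into the replayed one. *)
Lemma replay_step (u : list (nat * fml)) :
  (forall k C, i <= k -> In (k, C) l -> ~ In (k, C) u ->
     replay ((k, C) :: filter (fun p => fst p <=? k) u)) ->
  replay u.
Proof.
intros Hnext.
cut (forall P V (Q : graph V) T, L P Q T -> (forall k C, P k C -> In (k, C) l) ->
  forall (y : V) (Z : V -> Prop) W' (E' : graph W') S' h g,
  extends E0 S0 E' S' h -> hom Q E' g -> sees E' i (h x0) (g y) ->
  (forall p, In p u -> spent E' S' (g y) p) ->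
  (forall v, Z v -> fresh_pair u E' S' (g y) (g v)) ->
  (forall j w v, w = y \/ Z w -> i <= j -> Q j w v -> Z v) ->
  (forall j w v, w = y \/ Z w -> i < j -> Q j v w -> v = y \/ Z v) ->
  (forall v G, T v G -> S' (g v) G \/ (v = y /\ G = Dia i (neg A))) ->
  D E' S').
{ intros Hcut W' E' S' h y' He Hy HA Hsp.
  (* Initially the fresh node [None] plays [y] and has no children, so [Z] is empty. *)
  apply (Hcut _ _ _ _ Hder (fun _ _ H => H) None (fun _ => False) _ E' S' h
           (fun o => match o with Some v => h v | None => y' end)); auto.
  - apply hom_lift; [apply He|exact Hy].
  - easy.
  - intros j w v [-> |[]] _ H; destruct H.
  (* An [i]-diamond cannot leave the fresh node upwards: this requires a label above [i], and the
     edge has label exactly [i]. *)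
  - intros j w v [-> |[]] Hj; destruct v as [v|]; [|now left].
    intros [_ ->]; lia.
  - intros [v|] G; simpl; [intros H; left; apply He, H|].
    intros [-> | ->]; auto. }
intros P V Q T H; induction H as
  [V Q T x p H1 H2|V Q T x H1|V Q T x B C H1 _ IH1 _ IH2
  |V Q T x B C H1 _ IH|V Q T x j C HP H1 _ IH|V Q T x j C z H1 H2 _ IH];
  intros Hl y Z W' E' S' h g He Hg Hy Hsp HZ Hdown Hup HT.
- destruct (HT _ _ H1) as [H1'|[_ ?]]; [|easy].
  destruct (HT _ _ H2) as [H2'|[_ ?]]; [|easy].
  eapply L_atom; eassumption.
- destruct (HT _ _ H1) as [H1'|[_ ?]]; [|easy].
  eapply L_top; eassumption.
- destruct (HT _ _ H1) as [H1'|[_ ?]]; [|easy].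
  apply (L_and H1').
  + apply (IH1 Hl y Z _ E' _ h g); auto.
    * apply extends_add, He.
    * intros p Hp; exact (spent_mono (extends_self_add _ _ _ _) (Hsp p Hp)).
    * intros v Hv; exact (fresh_pair_mono (extends_self_add _ _ _ _) (HZ v Hv)).
    * intros v G [Hv|[-> ->]]; [destruct (HT _ _ Hv)|]; auto.
  + apply (IH2 Hl y Z _ E' _ h g); auto.
    * apply extends_add, He.
    * intros p Hp; exact (spent_mono (extends_self_add _ _ _ _) (Hsp p Hp)).
    * intros v Hv; exact (fresh_pair_mono (extends_self_add _ _ _ _) (HZ v Hv)).
    * intros v G [Hv|[-> ->]]; [destruct (HT _ _ Hv)|]; auto.
- destruct (HT _ _ H1) as [H1'|[_ ?]]; [|easy].
  apply (L_or H1').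
  assert (Hx : extends E' S' E' (add (add S' (g x) B) (g x) C) (fun u => u)).
  { apply extends_add, extends_self_add. }
  apply (IH Hl y Z _ E' _ h g); auto.
  + do 2 apply extends_add; exact He.
  + intros p Hp; exact (spent_mono Hx (Hsp p Hp)).
  + intros v Hv; exact (fresh_pair_mono Hx (HZ v Hv)).
  + intros v G [[Hv|[-> ->]]|[-> ->]]; [destruct (HT _ _ Hv)| |]; auto.
- destruct (HT _ _ H1) as [H1'|[_ ?]]; [|easy].
  set (E1 := grow E' (g x) j); set (S1 := spawn S' (loeb_pair j C)).
  assert (Hx : extends E' S' E1 S1 Some).
  { split; [apply hom_grow|auto]. }
  (* The box rule is repeated in the replay; [Z'] extends [Z] by a decision whether the new node
     belongs to it. *)
  assert (Hgo : forall Z' : option V -> Prop,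
    (forall v, Z' (Some v) <-> Z v) ->
    (Z' None -> fresh_pair u E1 S1 (Some (g y)) None) ->
    (x = y \/ Z x -> i <= j -> Z' None) ->
    (Z' None -> x = y \/ Z x) -> D E' S').
  { intros Z' HZ' Hnone Hin Hout; apply (L_box I H1').
    apply (IH Hl (Some y) Z' _ E1 S1 (fun u => Some (h u)) (option_map g)).
    - apply extends_grow, He.
    - apply hom_option_map, Hg.
    - exact (sees_hom (proj1 Hx) Hy).
    - intros p Hp; exact (spent_mono Hx (Hsp p Hp)).
    - intros [v|] Hv; [|exact (Hnone Hv)].
      apply HZ' in Hv; exact (fresh_pair_mono Hx (HZ v Hv)).
    - intros k [w|] [v|] Hw Hk; simpl; try easy.
      + intros HQ; apply HZ'; apply (Hdown k w); auto.
        destruct Hw as [[= ->]|Hw]; [now left|right; apply HZ', Hw].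
      + intros [-> ->]; apply Hin; [|exact Hk].
        destruct Hw as [[= ->]|Hw]; [now left|right; apply HZ', Hw].
    - intros k [w|] [v|] Hw Hk; simpl; try easy.
      + intros HQ; destruct (Hup k w v) as [-> |Hv]; auto.
        * destruct Hw as [[= ->]|Hw]; [now left|right; apply HZ', Hw].
        * right; apply HZ', Hv.
      + intros [-> ->]; destruct Hw as [|Hw]; [easy|].
        destruct (Hout Hw) as [-> |Hxz]; [now left|right; apply HZ', Hxz].
    - intros [v|] G Hv; simpl in *; [|auto].
      destruct (HT _ _ Hv) as [|[-> ->]]; auto. }
  assert (Hnew : sees E1 j (Some (g x)) None)
    by (apply sees_edge with (j := j); [lia|simpl; auto]).
  assert (Hself : spent E1 S1 None (j, C)).
  { exists None; split; [right; reflexivity|now left]. }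
  (* Here the path from [y] to the new node has level [j]. If [(j, C)] is in [u], it is spent at [x]
     as well and the box closes at once; otherwise it is the fresh pair of the new node. *)
  assert (Hj : x = y \/ sees E' j (g y) (g x) -> i <= j ->
    x = y \/ Z x -> D E' S').
  { intros Hyx Hij Hxz; destruct (classic (In (j, C) u)) as [Hu|Hu].
    - apply (spent_box H1'); destruct Hyx as [-> |Hyx]; [auto|].
      exact (spent_sees (p := (j, C)) (le_n j) Hyx (Hsp _ Hu)).
    - apply (Hgo (fun o => match o with Some v => Z v | None => True end)); try easy.
      intros _; exists j, C; repeat split; auto.
      destruct Hyx as [-> |Hyx]; [exact Hnew|].
      exact (sees_trans (sees_hom (proj1 Hx) Hyx) Hnew). }
  (* The new node joins [Z] exactly when its label is at least [i] and its parent is [y] or in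
     [Z]. *)
  destruct (le_lt_dec i j) as [Hij|Hij].
  + destruct (classic (x = y)) as [Hxy|Hxy]; [auto|].
    destruct (classic (Z x)) as [Hxz|Hxz].
    * destruct (HZ _ Hxz) as (k & F & Hk & Hkl & Hku & Hs & Hks).
      (* If [k <= j], the pair spent at [x] stays spent at the new node; otherwise [j] is the new
         least label. *)
      destruct (le_lt_dec k j) as [Hkj|Hkj].
      -- apply (Hgo (fun o => match o with Some v => Z v | None => True end)); try easy.
         2: now right.
         intros _; exists k, F; repeat split; auto.
         ++ exact (sees_trans (sees_hom (proj1 Hx) Hs) (sees_le Hkj Hnew)).
         ++ exact (spent_sees (p := (k, F)) Hkj Hnew (spent_mono Hx Hks)).
      -- apply Hj; auto; right; apply (sees_le (k := k)); [lia|exact Hs].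
    * apply (Hgo (fun o => match o with Some v => Z v | None => False end)); try easy.
      intros [|]; easy.
  + apply (Hgo (fun o => match o with Some v => Z v | None => False end)); try easy.
    intros _ ?; lia.
- assert (Hprem : D E' (add S' (g z) C)).
  { apply (IH Hl y Z _ E' _ h g); auto.
    - apply extends_add, He.
    - intros p Hp; exact (spent_mono (extends_self_add _ _ _ _) (Hsp p Hp)).
    - intros v Hv; exact (fresh_pair_mono (extends_self_add _ _ _ _) (HZ v Hv)).
    - intros v G [Hv|[-> ->]]; [destruct (HT _ _ Hv)|]; auto. }
  destruct (HT _ _ H1) as [H1'|[-> [= -> ->]]].
  + exact (L_dia H1' (sees_hom Hg H2) Hprem).
  (* The missing diamond itself is used. Its target lies in [Z] because [y] together with [Z] is
     closed under moves of level [i]. *)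
  + assert (HZz : Z z).
    { destruct H2 as (k & w & Hr & Hk & HQ); apply (Hdown k w); [clear HQ|exact Hk|exact HQ].
      apply clos_rt_rtn1 in Hr; induction Hr as [|a b Hab Hr IHr]; [now left|].
      destruct Hab as [m a b Hm Hab|m a b Hm Hab].
      - right; exact (Hdown m _ _ IHr Hm Hab).
      - exact (Hup m _ _ IHr Hm Hab). }
    (* The cut premise with [A] at [g z] is a replay there: the fresh pair is spent, and so are the
       pairs of [u] of level at most [k]. *)
    apply (cutA (x := g z)); [|exact Hprem].
    destruct (HZ _ HZz) as (k & F & Hk & Hkl & Hku & Hs & Hks).
    apply (Hnext k F Hk Hkl Hku _ E' _ h (g z)).
    * apply extends_add, He.
    * exact (sees_trans Hy (sees_le Hk Hs)).
    * auto.
    * intros p [<- |Hp].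
      -- exact (spent_mono (extends_self_add _ _ _ _) Hks).
      -- apply filter_In in Hp as [Hp Hpk]; apply Nat.leb_le in Hpk.
         exact (spent_mono (extends_self_add _ _ _ _) (spent_sees Hpk Hs (Hsp p Hp))).
Qed.

(** Duplicate-free lists over [l] have bounded potential, and each use of [replay_step] raises it;
    the induction is on the distance to the bound. *)
Lemma replay_all (u : list (nat * fml)) : NoDup u -> incl u l -> replay u.
Proof.
set (N := list_max (map fst l)); set (M := length l).
assert (HN : forall p, In p l -> fst p <= N).
{ intros p Hp; assert (H := proj1 (list_max_le (map fst l) N) (le_n _)).
  rewrite Forall_forall in H; apply H, in_map, Hp. }
assert (HM : forall v, NoDup v -> incl v l -> length v <= M).
{ intros v; apply NoDup_incl_length. }
remember (M * (M + 1) ^ N - potential N M u) as n eqn:Hn.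
revert u Hn; induction n as [n IH] using lt_wf_ind; intros u -> Hnd Hincl.
apply replay_step; intros k C Hk Hkl Hku.
set (u' := (k, C) :: filter (fun p => fst p <=? k) u).
assert (Hnd' : NoDup u').
{ constructor; [rewrite filter_In; tauto|apply NoDup_filter, Hnd]. }
assert (Hincl' : incl u' l).
{ intros p [<- |Hp]; [exact Hkl|apply filter_In in Hp as [Hp _]; auto]. }
apply (IH (M * (M + 1) ^ N - potential N M u')); auto.
assert (H1 := potential_increase (N := N) (M := M) (k := k) C u
  (fun p Hp => HN p (Hincl p Hp)) (HN _ Hkl) (HM u Hnd Hincl)).
assert (H2 := potential_bound N u' (HM u' Hnd' Hincl')).
unfold u' in *; lia.
Qed.

End Loeb.

(** The replay at the fresh node itself, with no pair assumed spent. *)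
Lemma D_loeb W (E : graph W) (S : content W) x i A :
  (forall W' (E' : graph W') (S' : content W') z,
     D E' (add S' z A) -> D E' (add S' z (neg A)) -> D E' S') ->
  D (grow E x i) (spawn S (loeb_pair i A)) -> D (grow E x i) (spawn S (eq A)).
Proof.
intros Hcut H; destruct (L_finite H) as [l Hl].
assert (Hr := replay_all Hcut Hl (NoDup_nil _) (incl_nil_l _)).
apply (Hr _ _ _ Some None).
- split; [apply hom_grow|auto].
- apply sees_edge with (j := i); [lia|simpl; auto].
- reflexivity.
- easy.
Qed.

(** * Cut elimination in the labelled calculus *)

(** Inverting the box and applying Loeb's rule derives [A] alone at a new child. Each use of the
    diamond in the other premise puts [neg A] at some [z], where it is cut against this derivation
    with the child mapped to [z]. *)
Lemma D_cut_box W (E : graph W) (S : content W) x i A :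
  (forall W' (E' : graph W') (S' : content W') z,
     D E' (add S' z A) -> D E' (add S' z (neg A)) -> D E' S') ->
  D E (add S x (Box i A)) -> D E (add S x (Dia i (neg A))) -> D E S.
Proof.
intros Hcut Hbox Hdia.
assert (Hinv : D (grow E x i) (spawn S (loeb_pair i A))).
{ apply (L_hom Hbox (hom_grow E x i)); intros v F [Hv|[-> ->]].
  - apply cov_in; exact Hv.
  - apply cov_box with (y := None).
    + apply sees_edge with (j := i); [lia|simpl; auto].
    + apply cov_in; left; reflexivity.
    + apply cov_in; right; reflexivity. }
apply D_loeb in Hinv; [|exact Hcut].
apply (D_erase (F := Dia i (neg A)) (x0 := x)); [exact I|easy| |exact Hdia].
intros k B [= <- <-] W' E' S' h z He Hs HB.
apply (Hcut _ _ _ z); [|exact HB].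
apply (L_hom Hinv (hom_lift (proj1 He) _ Hs)); intros [v|] F; simpl.
- intros Hv; apply cov_in, add_l, He, Hv.
- intros <-; apply cov_in, add_r.
Qed.

Lemma D_cut_or W (E : graph W) (S : content W) x A B :
  (forall W' (E' : graph W') (S' : content W') z,
     D E' (add S' z A) -> D E' (add S' z (neg A)) -> D E' S') ->
  (forall W' (E' : graph W') (S' : content W') z,
     D E' (add S' z B) -> D E' (add S' z (neg B)) -> D E' S') ->
  D E (add S x (Or A B)) -> D E (add S x (And (neg A) (neg B))) -> D E S.
Proof.
intros HA HB Hor Hand.
assert (Hl : D E (add S x (neg A))).
{ apply (L_hom Hand (hom_id E)); intros v F [Hv|[-> ->]];
    [|apply cov_andl]; apply cov_in; auto. }
assert (Hr : D E (add S x (neg B))).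
{ apply (L_hom Hand (hom_id E)); intros v F [Hv|[-> ->]];
    [|apply cov_andr]; apply cov_in; auto. }
apply (HB _ _ _ x); [|exact Hr].
apply (HA _ _ _ x).
- apply (L_hom Hor (hom_id E)); intros v F [Hv|[-> ->]]; [|apply cov_or];
    apply cov_in; auto.
- apply (L_incl (S := add S x (neg A))); [|exact Hl].
  intros v F [Hv|[-> ->]]; auto.
Qed.

Lemma D_cut_bot W (E : graph W) (S : content W) x : D E (add S x (Bot atom)) -> D E S.
Proof. now apply D_erase. Qed.

Lemma D_cut_atom W (E : graph W) (S : content W) x p :
  D E (add S x (Atom p)) -> D E (add S x (NAtom p)) -> D E S.
Proof.
intros H1 H2; apply (D_erase (F := Atom p) (x0 := x)); [exact I| |easy|exact H1].
intros q [= <-] W' E' S' h He Hq.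
apply (L_hom H2 (proj1 He)); intros v F [Hv|[-> ->]]; apply cov_in; [apply He, Hv|exact Hq].
Qed.

Theorem D_cut (F : fml) : forall W (E : graph W) (S : content W) x,
  D E (add S x F) -> D E (add S x (neg F)) -> D E S.
Proof.
induction F as [p|p| | |A IHA B IHB|A IHA B IHB|i A IHA|i A IHA];
  intros W E S x H1 H2; simpl in *.
- exact (D_cut_atom H1 H2).
- exact (D_cut_atom H2 H1).
- exact (D_cut_bot H2).
- exact (D_cut_bot H1).
(* Since [neg] is involutive, this is the disjunction case for the negated components. *)
- apply (D_cut_or (x := x) (A := neg A) (B := neg B)); rewrite ?neg_involutive; eauto.
- apply (D_cut_or (x := x) (A := A) (B := B)); eauto.
- apply (D_cut_box (x := x) (i := i) (A := A)); eauto.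
- apply (D_cut_box (x := x) (i := i) (A := neg A)); rewrite ?neg_involutive; eauto.
Qed.

End Labelled.

(** * Nested sequents as labelled sequents *)

Section Nested.

Variable atom : Type.
Notation fml := (formula atom).
Notation seqt := (sequent atom).

Fixpoint nest (C : context atom) (i : nat) (R : seqt) : context atom :=
  match C with
  | Hole D => InBrk i (Hole R) D
  | InBrk j C D => InBrk j (nest C i R) D
  end.

Lemma fill_nest C i U R : fill (nest C i R) U = fill C [Brk i (U ++ R)].
Proof. induction C as [D|j C IH D]; simpl; [reflexivity|now rewrite IH]. Qed.

(** * From nested proofs to labelled derivations *)

Section Realization.

Variables (W : Type) (E : graph W) (S : content atom W).

(* A diamond may sit at any node from which tran and eucl can bring it to [x]. *)
Definition holds (x : W) (F : fml) : Prop :=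
  match F with
  | Dia i _ => exists v, S v F /\ reach E i v x
  | _ => S x F
  end.

Lemma holds_in x F : S x F -> holds x F.
Proof. destruct F; simpl; auto; intros H; exists x; split; [exact H|apply rt_refl]. Qed.

(** Only presence is asked: brackets may share a node, which need only be seen, and the content may
    be larger. This makes realizations stable under [extends]. *)
Inductive real : W -> seqt -> Prop :=
| real_nil x : real x []
| real_fml x F G : holds x F -> real x G -> real x (Fml F :: G)
| real_brk x i y H G : sees E i x y -> real y H -> real x G -> real x (Brk i H :: G).

Lemma real_app x G H : real x (G ++ H) <-> real x G /\ real x H.
Proof.
split.
- induction G as [|I G IH]; simpl; intros HG; [split; [constructor|exact HG]|].
  inversion HG; subst; destruct IH as [H1 H2]; auto; split; auto;
    econstructor; eassumption.
- intros [HG HH]; induction G as [|I G IH]; simpl; [exact HH|].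
  inversion HG; subst; econstructor; eauto.
Qed.

Lemma real_perm x G H : Permutation G H -> real x G -> real x H.
Proof.
intros HP; induction HP as [|I G H _ IH|I J G|G H K _ IH1 _ IH2]; intros HG; auto.
- inversion HG; subst; econstructor; eauto.
- change (real x ([J; I] ++ G)) in HG; change (real x ([I] ++ [J] ++ G)).
  apply real_app in HG as [HG1 HG2]; change (real x ([J] ++ [I])) in HG1.
  rewrite !real_app in *; tauto.
Qed.

Lemma real_meq G H : meq G H -> forall x, real x G -> real x H.
Proof.
induction 1 as [G H HP|i G G' H _ IH|G H K _ IH1 _ IH2]; intros x HG.
- exact (real_perm HP HG).
- inversion HG; subst; econstructor; eauto.
- auto.
Qed.

End Realization.

Lemma holds_ext W W' (E : graph W) (E' : graph W') S S' h x F :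
  extends E S E' S' h -> holds E S x F -> holds E' S' (h x) F.
Proof.
intros [Hh HS]; destruct F; simpl; auto.
intros (v & Hv & Hr); exists (h v); split; [auto|exact (reach_hom Hh Hr)].
Qed.

Lemma real_ext W W' (E : graph W) (E' : graph W') S S' h x G :
  extends E S E' S' h -> real E S x G -> real E' S' (h x) G.
Proof.
intros He H; induction H as [x|x F G HF _ IH|x i y H G Hs _ IH1 _ IH2].
- constructor.
- apply real_fml; [exact (holds_ext x F He HF)|exact IH].
- exact (real_brk (sees_hom (proj1 He) Hs) IH1 IH2).
Qed.

(** [y] is the node of the hole. Refilling the hole at a later stage is how a realization of a
    conclusion becomes one of a premise. *)
Lemma real_fill W (E : graph W) S C U x : real E S x (fill C U) ->
  exists y, real E S y U /\
  forall W' (E' : graph W') S' h U', extends E S E' S' h ->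
    real E' S' (h y) U' -> real E' S' (h x) (fill C U').
Proof.
revert x; induction C as [R|i C IH R]; simpl; intros x H.
- apply real_app in H as [HU HR]; exists x; split; [exact HU|].
  intros W' E' S' h U' He HU'; apply real_app; split; [exact HU'|].
  exact (real_ext He HR).
- inversion H as [| |? ? y ? ? Hs HC HR]; subst.
  destruct (IH y HC) as (z & Hz & Hfill); exists z; split; [exact Hz|].
  intros W' E' S' h U' He HU'.
  exact (real_brk (sees_hom (proj1 He) Hs) (Hfill _ _ _ _ _ He HU') (real_ext He HR)).
Qed.

Definition valid (G : seqt) : Prop :=
  forall W (E : graph W) S x, real E S x G -> D E S.

(** Each logical rule becomes its labelled counterpart at the node of the hole. The rules tran and
    eucl leave the labelled sequent unchanged, because [holds] already lets diamonds travel along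
    [reach]. *)
Lemma valid_step Ps G :
  GLP_NS Ps G -> (forall P, In P Ps -> valid P) -> valid G.
Proof.
intros H HP W E S x HG.
destruct H as [C p|C|C A B|C A B|C i A|C i j A R Hij|C i j A R Hij|C i j A R Hij];
  apply real_fill in HG as (y & Hy & Hfill).
- inversion Hy as [|? ? ? H1 Hy'|]; subst; inversion Hy' as [|? ? ? H2 _|]; subst.
  apply L_atom with (x := y) (p := p); assumption.
- inversion Hy as [|? ? ? H1 Hy'|]; subst.
  apply L_top with (x := y); exact H1.
- inversion Hy as [|? ? ? H1 _|]; subst.
  simpl in H1; apply (L_and H1).
  + apply (HP _ (or_introl eq_refl) _ _ _ x), (Hfill _ _ _ (fun u => u)).
    * apply extends_self_add.
    * repeat constructor; apply holds_in, add_r.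
  + apply (HP _ (or_intror (or_introl eq_refl)) _ _ _ x), (Hfill _ _ _ (fun u => u)).
    * apply extends_self_add.
    * repeat constructor; apply holds_in, add_r.
- inversion Hy as [|? ? ? H1 _|]; subst.
  simpl in H1; apply (L_or H1).
  apply (HP _ (or_introl eq_refl) _ _ _ x), (Hfill _ _ _ (fun u => u)).
  + apply extends_add, extends_self_add.
  + repeat constructor; apply holds_in; [apply add_l|]; apply add_r.
- inversion Hy as [|? ? ? H1 _|]; subst.
  simpl in H1; apply (L_box I H1).
  apply (HP _ (or_introl eq_refl) _ _ _ (Some x)), (Hfill _ _ _ Some).
  + split; [apply hom_grow|auto].
  + apply real_brk with (y := None); [|repeat constructor; apply holds_in|constructor].
    * apply sees_edge with (j := i); [lia|simpl; auto].
    * now left.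
    * now right.
- inversion Hy as [|? ? ? H1 Hy'|]; subst.
  inversion Hy' as [| |? ? z ? ? Hs HR _]; subst.
  destruct H1 as (v & Hv & Hr).
  apply (L_dia Hv (reach_sees Hr (sees_le Hij Hs))).
  apply (HP _ (or_introl eq_refl) _ _ _ x), (Hfill _ _ _ (fun u => u)).
  + apply extends_self_add.
  + apply real_fml.
    * exists v; split; [apply add_l, Hv|exact Hr].
    * apply (real_brk (y := z)); [exact Hs| |constructor].
      apply real_fml; [apply holds_in, add_r|].
      exact (real_ext (extends_self_add _ _ _ _) HR).
- apply (HP _ (or_introl eq_refl) _ _ _ x), (Hfill _ _ _ (fun u => u)).
  + split; [apply hom_id|auto].
  + inversion Hy as [|? ? ? H1 Hy'|]; subst.
    inversion Hy' as [| |? ? z ? ? Hs HR _]; subst.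
    apply real_fml; [exact H1|apply (real_brk (y := z)); [exact Hs| |constructor]].
    apply real_fml; [|exact HR].
    destruct H1 as (v & Hv & Hr); exists v; split; [exact Hv|].
    exact (rt_trans _ _ _ _ _ Hr (sees_reach (sees_le Hij Hs))).
- apply (HP _ (or_introl eq_refl) _ _ _ x), (Hfill _ _ _ (fun u => u)).
  + split; [apply hom_id|auto].
  + apply real_fml; [|exact Hy].
    inversion Hy as [| |? ? z ? ? Hs HR _]; subst.
    inversion HR as [|? ? ? H1 _|]; subst.
    destruct H1 as (v & Hv & Hr); exists v; split; [exact Hv|].
    exact (rt_trans _ _ _ _ _ Hr (reach_sym Hij (sees_reach Hs))).
Qed.

Lemma valid_provable_cut G : provable (@GLP_NS_cut atom) G -> valid G.
Proof.
induction 1 as [Ps G G' HR Hmeq _ IH].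
intros W E S x Hx; apply (real_meq (Equivalence_Symmetric _ _ Hmeq)) in Hx; revert W E S x Hx.
destruct HR as [Ps G HR|C A]; [exact (valid_step HR IH)|].
intros W E S x Hx; apply real_fill in Hx as (y & _ & Hfill).
apply (D_cut (F := A) (x := y)).
- apply (IH _ (or_introl eq_refl) _ _ _ x), (Hfill _ _ _ (fun u => u)).
  + apply extends_self_add.
  + repeat constructor; apply holds_in, add_r.
- apply (IH _ (or_intror (or_introl eq_refl)) _ _ _ x), (Hfill _ _ _ (fun u => u)).
  + apply extends_self_add.
  + repeat constructor; apply holds_in, add_r.
Qed.

(** * From labelled derivations back to nested proofs *)

Notation prov := (provable (@GLP_NS atom)).

Lemma provable_meq G H : meq G H -> prov G -> prov H.
Proof.
intros Hm HG; destruct HG as [Ps G0 G HR Hm0 HP].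
exact (provable_step _ HR (meq_trans Hm0 Hm) HP).
Qed.

(* A tree of nodes [nat] is listed as edges (parent, label, child), every edge
   before those leading to its parent; items are tagged with their node.
   [collapse] folds the first child back into its parent; items at any node
   that is not a child end up at the root. *)
Definition edges := list (nat * nat * nat).
Definition items := list (nat * item atom).

Definition tag (x : nat) (U : seqt) : items := map (pair x) U.
Definition at_node (x : nat) (T : items) : items := filter (fun p => fst p =? x) T.
Definition off_node (x : nat) (T : items) : items := filter (fun p => negb (fst p =? x)) T.

Fixpoint collapse (es : edges) (T : items) : seqt :=
  match es with
  | [] => map snd T
  | (p, k, x) :: es =>
      collapse es ((p, Brk k (map snd (at_node x T))) :: off_node x T)
  end.

Lemma fill_meq (C : context atom) U U' : meq U U' -> meq (fill C U) (fill C U').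
Proof.
intros HU; induction C as [R|i C IH R]; simpl; [|exact (meq_brk _ _ IH)].
induction HU as [U U' HP|i U U' R' HU _|U V U' _ IH1 _ IH2].
- apply meq_perm, Permutation_app_tail, HP.
- exact (meq_brk _ _ HU).
- exact (meq_trans IH1 IH2).
Qed.

Lemma at_node_app x T1 T2 : at_node x (T1 ++ T2) = at_node x T1 ++ at_node x T2.
Proof. apply filter_app. Qed.

Lemma off_node_app x T1 T2 : off_node x (T1 ++ T2) = off_node x T1 ++ off_node x T2.
Proof. apply filter_app. Qed.

Lemma at_node_same x U : map snd (at_node x (tag x U)) = U.
Proof.
induction U as [|I U IH]; simpl; [reflexivity|].
rewrite Nat.eqb_refl; simpl; now rewrite IH.
Qed.

Lemma off_node_same x U : off_node x (tag x U) = [].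
Proof. induction U as [|I U IH]; simpl; [reflexivity|]; now rewrite Nat.eqb_refl. Qed.

Lemma at_node_none y T : (forall x I, In (x, I) T -> y <> x) -> at_node y T = [].
Proof.
induction T as [|[x I] T IH]; simpl; intros H; [reflexivity|].
rewrite (proj2 (Nat.eqb_neq x y) (fun e => H x I (or_introl eq_refl) (eq_sym e))).
eauto.
Qed.

Lemma off_node_none y T : (forall x I, In (x, I) T -> y <> x) -> off_node y T = T.
Proof.
induction T as [|[x I] T IH]; simpl; intros H; [reflexivity|].
rewrite (proj2 (Nat.eqb_neq x y) (fun e => H x I (or_introl eq_refl) (eq_sym e))).
simpl; f_equal; eauto.
Qed.

Lemma in_tag x U y I : In (y, I) (tag x U) <-> y = x /\ In I U.
Proof.
unfold tag; rewrite in_map_iff; split.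
- intros (J & [= <- <-] & HJ); auto.
- intros [-> HI]; eauto.
Qed.

Lemma at_node_neq x y U : x <> y -> at_node y (tag x U) = [].
Proof. intros H; apply at_node_none; intros z I [-> _]%in_tag; auto. Qed.

Lemma off_node_neq x y U : x <> y -> off_node y (tag x U) = tag x U.
Proof. intros H; apply off_node_none; intros z I [-> _]%in_tag; auto. Qed.

(** Folding depends only on the nodes of the items, never on the items, so what lies at [x] stays
    together and fills one hole. *)
Lemma context_at_node es T1 T2 x :
  exists C, forall X, meq (collapse es (T1 ++ tag x X ++ T2)) (fill C X).
Proof.
revert T1 T2 x; induction es as [|[[p k] y] es IH]; intros T1 T2 x; simpl.
- exists (Hole (map snd (T1 ++ T2))); intros X; simpl.
  unfold tag; rewrite !map_app, map_map, map_id; apply meq_perm.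
  apply Permutation_app_swap_app.
- setoid_rewrite at_node_app; setoid_rewrite at_node_app.
  setoid_rewrite off_node_app; setoid_rewrite off_node_app.
  destruct (Nat.eq_dec x y) as [<- |Hxy].
  (* Folding [x] turns its items into one bracket at [p]; the hole is moved inside that bracket by
     [nest]. *)
  + destruct (IH [] (off_node x T1 ++ off_node x T2) p) as [C HC].
    exists (nest C k (map snd (at_node x T1) ++ map snd (at_node x T2))); intros X.
    rewrite off_node_same, fill_nest, !map_app, at_node_same.
    etransitivity; [apply (HC [_])|].
    apply fill_meq, meq_brk, meq_perm, Permutation_app_swap_app.
  + destruct (IH ((p, Brk k (map snd (at_node y T1 ++ at_node y T2))) :: off_node y T1)
      (off_node y T2) x) as [C HC].
    exists C; intros X; rewrite at_node_neq, off_node_neq by exact Hxy; apply HC.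
Qed.

Lemma filter_perm (A : Type) (f : A -> bool) l l' :
  Permutation l l' -> Permutation (filter f l) (filter f l').
Proof.
induction 1 as [|a l l' _ IH|a b l|l1 l2 l3 _ IH1 _ IH2]; simpl.
- constructor.
- destruct (f a); [constructor|]; exact IH.
- destruct (f a), (f b); try constructor; try apply Permutation_refl.
- exact (Permutation_trans IH1 IH2).
Qed.

Lemma collapse_perm es T T' : Permutation T T' -> meq (collapse es T) (collapse es T').
Proof.
revert T T'; induction es as [|[[p k] y] es IH]; intros T T' HT; simpl.
- apply meq_perm, Permutation_map, HT.
- destruct (context_at_node es [] (off_node y T) p) as [C HC].
  etransitivity; [|apply IH, perm_skip, filter_perm, HT].
  etransitivity; [apply (HC [_])|]; etransitivity; [|symmetry; apply (HC [_])].
  apply fill_meq, meq_brk, meq_perm, Permutation_map, filter_perm, HT.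
Qed.

(** No edge of [es1] folds [n] or [m], so both keep their items until [m] is folded into [n]; [R]
    collects what else is at [m] by then. *)
Lemma context_at_edge es1 es2 n k m T : n <> m ->
  (forall p j y, In (p, j, y) es1 -> y <> n /\ y <> m) ->
  exists C R, forall X Y,
    meq (collapse (es1 ++ (n, k, m) :: es2) (tag n X ++ tag m Y ++ T))
        (fill C (X ++ [Brk k (Y ++ R)])).
Proof.
intros Hnm; revert T; induction es1 as [|[[p j] y] es1 IH]; intros T Hes1; simpl.
- destruct (context_at_node es2 [] (off_node m T) n) as [C HC].
  exists C, (map snd (at_node m T)); intros X Y; rewrite <- HC.
  rewrite !at_node_app, !off_node_app, at_node_neq, off_node_neq, off_node_same by auto.
  simpl; rewrite map_app, at_node_same; apply collapse_perm.
  unfold tag; rewrite map_app, <- app_assoc; simpl; apply Permutation_middle.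
- destruct (Hes1 p j y (or_introl eq_refl)) as [Hn Hm].
  destruct (IH ((p, Brk j (map snd (at_node y T))) :: off_node y T)) as (C & R & HC).
  { intros q i z Hz; apply (Hes1 q i z); right; exact Hz. }
  exists C, R; intros X Y; rewrite <- HC; apply collapse_perm.
  rewrite !at_node_app, !off_node_app, !at_node_neq, !off_node_neq by auto; simpl.
  rewrite !app_assoc; apply Permutation_middle.
Qed.

(** A child occurs in no later edge: it has one parent, and its own children are folded before
    it. *)
Fixpoint wf (es : edges) : Prop :=
  match es with
  | [] => True
  | (p, k, x) :: es =>
      p <> x /\ (forall n j m, In (n, j, m) es -> x <> n /\ x <> m) /\ wf es
  end.

Lemma wf_split es n k m : wf es -> In (n, k, m) es ->
  exists es1 es2, es = es1 ++ (n, k, m) :: es2 /\ n <> m /\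
    forall p j y, In (p, j, y) es1 -> y <> n /\ y <> m.
Proof.
induction es as [|[[p j] x] es IH]; simpl; [easy|].
intros (Hpx & Hx & Hwf) [[= -> -> ->]|Hin].
- exists [], es; repeat split; auto; easy.
- destruct (IH Hwf Hin) as (es1 & es2 & -> & Hnm & Hes1).
  exists ((p, j, x) :: es1), es2; repeat split; auto;
    destruct H as [[= <- <- <-]|H]; try apply (Hes1 _ _ _ H);
    apply (Hx n k m); apply in_or_app; simpl; auto.
Qed.

Lemma exists_fresh (es : edges) (T : items) : exists z,
  (forall n j m, In (n, j, m) es -> z <> n /\ z <> m) /\
  (forall x I, In (x, I) T -> z <> x).
Proof.
set (l := map fst T ++ map (fun e => fst (fst e)) es ++ map snd es).
exists (S (list_max l)).
assert (Hl : forall x, In x l -> S (list_max l) <> x).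
{ intros x Hx; assert (H := proj1 (list_max_le l _) (le_n _)).
  rewrite Forall_forall in H; specialize (H x Hx); lia. }
split.
- intros n j m He; split; apply Hl; unfold l; rewrite !in_app_iff.
  + right; left; exact (in_map (fun e => fst (fst e)) _ _ He).
  + right; right; exact (in_map snd _ _ He).
- intros x I HI; apply Hl; unfold l; rewrite in_app_iff; left; exact (in_map fst _ _ HI).
Qed.

Definition egraph (es : edges) : graph nat := fun k p x => In (p, k, x) es.
Definition cont (T : items) : content atom nat := fun x F => In (x, Fml F) T.

(** A move down is an instance of tran, a move up one of eucl. *)
Lemma prov_dia_step es T i A x y : wf es -> move (egraph es) i x y ->
  In (x, Fml (Dia i A)) T ->
  prov (collapse es ((y, Fml (Dia i A)) :: T)) -> prov (collapse es T).
Proof.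
intros Hwf Hmove HT Hprem; apply in_split in HT as (T1 & T2 & ->).
destruct Hmove as [j n m Hij He|j m n Hij He];
  destruct (wf_split _ _ _ _ Hwf He) as (es1 & es2 & -> & Hnm & Hes1);
  destruct (context_at_edge es1 es2 j (T1 ++ T2) Hnm Hes1)
    as (C & R & HC).
- eapply provable_step.
  + exact (rule_tran C A R Hij).
  + etransitivity; [symmetry; exact (HC [Fml (Dia i A)] [])|].
    apply collapse_perm; simpl; apply Permutation_middle.
  + intros P [<- |[]]; eapply provable_meq; [|exact Hprem].
    etransitivity; [|exact (HC [Fml (Dia i A)] [Fml (Dia i A)])].
    apply collapse_perm; simpl.
    etransitivity; [apply perm_skip; symmetry; apply Permutation_middle|apply perm_swap].
- eapply provable_step.
  + exact (rule_eucl C A R Hij).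
  + etransitivity; [symmetry; exact (HC [] [Fml (Dia i A)])|].
    apply collapse_perm; simpl; apply Permutation_middle.
  + intros P [<- |[]]; eapply provable_meq; [|exact Hprem].
    etransitivity; [|exact (HC [Fml (Dia i A)] [Fml (Dia i A)])].
    apply collapse_perm; simpl.
    apply perm_skip; symmetry; apply Permutation_middle.
Qed.

(** The premise allows any larger [T'] because copies of the diamond remain at the nodes passed. *)
Lemma prov_dia_reach es T i A x y : wf es -> reach (egraph es) i x y ->
  In (x, Fml (Dia i A)) T ->
  (forall T', incl T T' -> In (y, Fml (Dia i A)) T' -> prov (collapse es T')) ->
  prov (collapse es T).
Proof.
intros Hwf Hr; apply clos_rt_rt1n in Hr; revert T.
induction Hr as [x|x x' y Hm _ IH]; intros T Hx Hprem.
- apply Hprem; [apply incl_refl|exact Hx].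
- apply (prov_dia_step _ _ Hwf Hm Hx), IH; [left; reflexivity|].
  intros T' HT'; apply Hprem; intros p Hp; apply HT'; right; exact Hp.
Qed.

Lemma prov_dia es T i A x y : wf es -> sees (egraph es) i x y ->
  In (x, Fml (Dia i A)) T ->
  (forall T', incl T T' -> In (y, Fml A) T' -> prov (collapse es T')) ->
  prov (collapse es T).
Proof.
intros Hwf (j & n & Hr & Hij & He) Hx Hprem.
apply (prov_dia_reach _ Hwf Hr Hx); intros T' HT' Hn.
assert (Hy : prov (collapse es ((y, Fml A) :: T'))).
{ apply Hprem; [|left; reflexivity]; intros p Hp; right; exact (HT' p Hp). }
apply in_split in Hn as (T1 & T2 & ->).
destruct (wf_split _ _ _ _ Hwf He) as (es1 & es2 & -> & Hnm & Hes1).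
destruct (context_at_edge es1 es2 j (T1 ++ T2) Hnm Hes1)
  as (C & R & HC).
eapply provable_step.
- exact (rule_dia C A R Hij).
- etransitivity; [symmetry; exact (HC [Fml (Dia i A)] [])|].
  apply collapse_perm; simpl; apply Permutation_middle.
- intros P [<- |[]]; eapply provable_meq; [|exact Hy].
  etransitivity; [|exact (HC [Fml (Dia i A)] [Fml A])].
  apply collapse_perm; simpl.
  etransitivity; [apply perm_skip; symmetry; apply Permutation_middle|apply perm_swap].
Qed.

(** Nested rules remove their principal formula while labelled ones keep it; the removed formula
    remains covered by its components. *)
Lemma cov_replace es es' T1 T2 T' x H y F :
  incl es es' -> incl (T1 ++ T2) T' -> cov (egraph es') (cont T') x H ->
  cov (egraph es) (cont (T1 ++ (x, Fml H) :: T2)) y F ->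
  cov (egraph es') (cont T') y F.
Proof.
intros Hes HT Hx; apply (cov_hom (f := fun u => u)).
- intros k u v He; apply sees_edge with (j := k); [lia|apply Hes, He].
- intros u G [Hu|[[= <- <-]|Hu]]%in_app_or.
  + apply cov_in, HT, in_or_app; now left.
  + exact Hx.
  + apply cov_in, HT, in_or_app; now right.
Qed.

(** A rule on a formula still listed in [T] becomes a nested rule. A formula removed earlier is only
    covered, and the labelled rule is then skipped as in [L_hom]. *)
Lemma provable_collapse P W (E : graph W) (S : content atom W) : L P E S ->
  forall es T f, wf es -> hom E (egraph es) f ->
  (forall u F, S u F -> cov (egraph es) (cont T) (f u) F) -> prov (collapse es T).
Proof.
intros H; induction H as
  [W E S x p H1 H2|W E S x H1|W E S x A B H1 _ IH1 _ IH2
  |W E S x A B H1 _ IH|W E S x i A HP H1 _ IH|W E S x i A y H1 H2 _ IH];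
  intros es T f Hwf Hf HS.
- apply HS in H1; apply HS in H2; inversion H1 as [? ? Ha| | | |];
    inversion H2 as [? ? Hb| | | |]; subst.
  apply in_split in Ha as (T1 & T2 & ->).
  assert (Hb' : In (f x, Fml (NAtom p)) (T1 ++ T2)).
  { apply in_app_or in Hb as [Hb|[Hb|Hb]]; [apply in_or_app; now left|easy|].
    apply in_or_app; now right. }
  apply in_split in Hb' as (T3 & T4 & HT).
  destruct (context_at_node es [] (T3 ++ T4) (f x)) as [C HC].
  eapply provable_step; [exact (init_atom C p)| |intros _ []].
  etransitivity; [symmetry; apply HC|]; apply collapse_perm; simpl.
  etransitivity; [apply perm_skip, Permutation_middle|]; rewrite <- HT.
  apply Permutation_middle.
- apply HS in H1; inversion H1 as [? ? Ha| | | |]; subst.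
  apply in_split in Ha as (T1 & T2 & ->).
  destruct (context_at_node es T1 T2 (f x)) as [C HC].
  eapply provable_step; [exact (init_top C)| |intros _ []].
  symmetry; apply (HC [_]).
- apply HS in H1; inversion H1 as [? ? Ha|? ? ? Ha|? ? ? Ha| |]; subst.
  + apply in_split in Ha as (T1 & T2 & ->).
    destruct (context_at_node es T1 T2 (f x)) as [C HC].
    assert (Hsub : forall G, incl (T1 ++ T2) (T1 ++ (f x, Fml G) :: T2)).
    { intros G q Hq; rewrite in_app_iff in *; simpl; tauto. }
    eapply provable_step; [exact (rule_and C A B)|symmetry; apply (HC [_])|].
    intros Q [<- |[<- |[]]]; (eapply provable_meq; [apply (HC [_])|]).
    * apply (IH1 _ _ f Hwf Hf); intros u F [Hu|[-> ->]].
      -- eapply cov_replace; [apply incl_refl|exact (Hsub A)| |exact (HS _ _ Hu)].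
         apply cov_andl, cov_in, in_elt.
      -- apply cov_in, in_elt.
    * apply (IH2 _ _ f Hwf Hf); intros u F [Hu|[-> ->]].
      -- eapply cov_replace; [apply incl_refl|exact (Hsub B)| |exact (HS _ _ Hu)].
         apply cov_andr, cov_in, in_elt.
      -- apply cov_in, in_elt.
  + apply (IH1 _ _ f Hwf Hf); intros u F [Hu|[-> ->]]; auto.
  + apply (IH2 _ _ f Hwf Hf); intros u F [Hu|[-> ->]]; auto.
- apply HS in H1; inversion H1 as [? ? Ha| | |? ? ? Ha Hb|]; subst.
  + apply in_split in Ha as (T1 & T2 & ->).
    destruct (context_at_node es T1 T2 (f x)) as [C HC].
    set (T' := T1 ++ tag (f x) [Fml A; Fml B] ++ T2).
    assert (Hsub : incl (T1 ++ T2) T').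
    { intros q Hq; unfold T'; rewrite !in_app_iff in *; tauto. }
    assert (HA : cov (egraph es) (cont T') (f x) A).
    { apply cov_in; unfold cont, T'; rewrite !in_app_iff; simpl; auto. }
    assert (HB : cov (egraph es) (cont T') (f x) B).
    { apply cov_in; unfold cont, T'; rewrite !in_app_iff; simpl; auto. }
    eapply provable_step; [exact (rule_or C A B)|symmetry; apply (HC [_])|].
    intros Q [<- |[]]; (eapply provable_meq; [apply HC|]).
    apply (IH _ _ f Hwf Hf); intros u F [[Hu|[-> ->]]|[-> ->]]; auto.
    eapply cov_replace; [apply incl_refl|exact Hsub|exact (cov_or HA HB)|exact (HS _ _ Hu)].
  + apply (IH _ _ f Hwf Hf); intros u F [[Hu|[-> ->]]|[-> ->]]; auto.
- apply HS in H1; inversion H1 as [? ? Ha| | | |? ? ? y Hs Ha Hb]; subst.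
  + assert (Hfx := Ha); apply in_split in Ha as (T1 & T2 & ->).
    destruct (context_at_node es T1 T2 (f x)) as [C HC].
    destruct (exists_fresh es (T1 ++ (f x, Fml (Box i A)) :: T2)) as (z & Hz1 & Hz2).
    assert (Hzx : z <> f x) by exact (Hz2 _ _ Hfx).
    assert (Hz : forall y I, In (y, I) (T1 ++ T2) -> z <> y).
    { intros y I HI; apply (Hz2 y I); rewrite in_app_iff in *; simpl; tauto. }
    set (U := [Fml A; Fml (Dia i (neg A))]).
    set (es' := (f x, i, z) :: es); set (T' := tag z U ++ T1 ++ T2).
    assert (Hes : incl es es') by (intros e He; right; exact He).
    assert (Hgraph : hom (egraph es) (egraph es') (fun u => u)).
    { intros k u v He; apply sees_edge with (j := k); [lia|apply Hes, He]. }
    assert (Hsees : sees (egraph es') i (f x) z).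
    { apply sees_edge with (j := i); [lia|left; reflexivity]. }
    assert (HA : cov (egraph es') (cont T') z A).
    { apply cov_in; left; reflexivity. }
    assert (HB : cov (egraph es') (cont T') z (Dia i (neg A))).
    { apply cov_in; right; left; reflexivity. }
    eapply provable_step; [exact (rule_box C i A)|symmetry; apply (HC [_])|].
    intros Q [<- |[]]; eapply provable_meq; [apply (HC [_])|].
    (* The edge to [z] stands first, so folding it yields exactly the bracket in the premise of the
       box rule. *)
    assert (Hfold : meq (collapse es' T') (collapse es (T1 ++ tag (f x) [Brk i U] ++ T2))).
    { change (collapse es' T') with
        (collapse es ((f x, Brk i (map snd (at_node z T'))) :: off_node z T')).
      unfold T'.
      rewrite at_node_app, off_node_app, off_node_same, map_app, at_node_same.
      rewrite (at_node_none _ Hz), (off_node_none _ Hz), app_nil_r.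
      exact (collapse_perm es (Permutation_middle T1 T2 (f x, Brk i U))). }
    apply (provable_meq Hfold).
    apply (IH _ _ (fun o => match o with Some u => f u | None => z end)).
    * simpl; auto.
    * apply hom_lift; [exact (hom_comp Hf Hgraph)|exact Hsees].
    * intros [u|] F; simpl; [|intros [-> | ->]; assumption].
      intros Hu; eapply cov_replace; [exact Hes| |exact (cov_box Hsees HA HB)|exact (HS _ _ Hu)].
      apply incl_appr, incl_refl.
  + apply (IH _ _ _ Hwf (hom_lift Hf _ Hs)).
    intros [u|] F; simpl; [auto|]; intros [-> | ->]; assumption.
- apply HS in H1; inversion H1 as [? ? Ha| | | |]; subst.
  apply (prov_dia _ Hwf (sees_hom Hf H2) Ha); intros T' HT' HA.
  apply (IH _ _ f Hwf Hf); intros u F [Hu|[-> ->]]; [|apply cov_in; exact HA].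
  apply (cov_incl (S := cont T)); [|auto].
  intros v G Hv; apply HT', Hv.
Qed.

(** * Flattening a nested sequent into a tree *)

Fixpoint brackets (I : item atom) : nat :=
  match I with
  | Fml _ => 0
  | Brk _ U => S (list_sum (map brackets U))
  end.

Definition all_brackets (T : items) : nat :=
  list_sum (map (fun p => brackets (snd p)) T).

Lemma all_brackets_app T1 T2 :
  all_brackets (T1 ++ T2) = all_brackets T1 + all_brackets T2.
Proof. unfold all_brackets; now rewrite map_app, list_sum_app. Qed.

Lemma real_items W (E : graph W) (S : content atom W) x G :
  (forall I, In I G -> real E S x [I]) -> real E S x G.
Proof.
induction G as [|I G IH]; intros H; [constructor|].
change (real E S x ([I] ++ G)); apply real_app; split; [apply H|apply IH; intros J HJ; apply H];
  simpl; auto.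
Qed.

(** A bracket at [x] is opened into a new child of [x], whose edge is put first so that [collapse]
    restores the bracket. The number of brackets at all depths drops by one each time. *)
Lemma flatten es T : wf es -> exists es' T',
  wf es' /\ incl es es' /\ meq (collapse es' T') (collapse es T) /\
  forall x I, In (x, I) T -> real (egraph es') (cont T') x [I].
Proof.
remember (all_brackets T) as n eqn:Hn; revert es T Hn.
induction n as [n IH] using lt_wf_ind; intros es T -> Hwf.
destruct (classic (exists x k U, In (x, Brk k U) T)) as [(x & k & U & HT)|HT].
- assert (Hx := HT); apply in_split in HT as (T1 & T2 & ->).
  destruct (exists_fresh es (T1 ++ (x, Brk k U) :: T2)) as (z & Hz1 & Hz2).
  assert (Hz : forall y I, In (y, I) (T1 ++ T2) -> z <> y).
  { intros y I HI; apply (Hz2 y I); rewrite in_app_iff in *; simpl; tauto. }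
  destruct (IH (all_brackets (tag z U ++ T1 ++ T2))) with
    (es := (x, k, z) :: es) (T := tag z U ++ T1 ++ T2)
    as (es' & T' & Hwf' & Hes & Hmeq & Hreal); auto.
  + rewrite !all_brackets_app; unfold all_brackets, tag; simpl; rewrite map_map; simpl.
    change (map (fun J => brackets J) U) with (map brackets U); lia.
  + simpl; repeat split; auto; try apply (Hz1 _ _ _ H).
    apply not_eq_sym, (Hz2 _ _ Hx).
  + exists es', T'; repeat split; auto.
    * intros e He; apply Hes; right; exact He.
    * etransitivity; [exact Hmeq|]; simpl.
      rewrite at_node_app, off_node_app, off_node_same, map_app, at_node_same.
      rewrite (at_node_none _ Hz), (off_node_none _ Hz), app_nil_r.
      apply collapse_perm; simpl; apply Permutation_middle.
    * intros y I [HI|[[= <- <-]|HI]]%in_app_or.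
      -- apply Hreal; rewrite !in_app_iff; auto.
      -- apply real_brk with (y := z); [|apply real_items|constructor].
         ++ apply sees_edge with (j := k); [lia|apply Hes; left; reflexivity].
         ++ intros I HI; apply Hreal, in_or_app; left; apply in_tag; auto.
      -- apply Hreal; rewrite !in_app_iff; auto.
- exists es, T; repeat split; auto; [apply incl_refl|reflexivity|].
  intros x [F|k U] HI; [|exfalso; eauto].
  repeat constructor; apply holds_in; exact HI.
Qed.

(** The tree flattened from [G] realizes [G], so validity derives it in the labelled calculus;
    collapsing that derivation proves [G]. *)
Lemma provable_valid G : valid G -> prov G.
Proof.
intros HG; destruct (@flatten [] (tag 0 G) I) as (es & T & Hwf & _ & Hmeq & Hreal).
assert (HD : D (egraph es) (cont T)).
{ apply (HG _ _ _ 0), real_items; intros J HJ; apply Hreal, in_tag; auto. }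
assert (Heq : collapse [] (tag 0 G) = G).
{ simpl; unfold tag; now rewrite map_map, map_id. }
rewrite Heq in Hmeq; apply (provable_meq Hmeq).
apply (provable_collapse HD (f := fun u => u) Hwf); [apply hom_id|].
intros u F Hu; apply cov_in, Hu.
Qed.

End Nested.

Theorem theorem18 (atom : Type) (G : sequent atom) :
  provable (@GLP_NS_cut atom) G -> provable (@GLP_NS atom) G.
Proof.
intros H; apply provable_valid, valid_provable_cut, H.
Qed.
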